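(* Let $r\in(0,1)$ have irrationality exponent $2$, and let $X_n\subseteq S^1$ be a set of $n$ points chosen independently and uniformly at random from $S^1$. Then for any $\varepsilon>0$, $\lim_{n\to\infty}\mathbf{P}[\mathrm{per}(X_n,r)>n^{1/2-\varepsilon}]=1$, and hence $\mathbf{E}[\mathrm{per}(X_n,r)]=\Omega(n^{1/2-\varepsilon})$.
   Context: $S^1=\mathbb{R}/\mathbb{Z}$ with arc-length metric; $[x,y)_{S^1}$ denotes the clockwise half-open arc from $x$ to $y$. For finite $X\subseteq S^1$ and $0<r\le1$, $f_r\colon X\to X$ sends $x$ to the element of $X\cap[x,x+r)_{S^1}$ clockwise furthest from $x$. A point is periodic if $f_r^i(x)=x$ for some $i\ge 1$; $\mathrm{per}(X,r)$ denotes the number of periodic points of $f_r\colon X\to X$. The irrationality exponent of a real number $r$ is the supremum of the set of real $\alpha$ for which $0<|r-\frac{p}{q}|<\frac{1}{q^\alpha}$ has infinitely many integer solutions $p,q$. *)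

(* Defs.v *)
From HB Require Import structures.
From mathcomp Require Import all_boot all_order all_algebra.
From mathcomp Require Import generic_quotient ring_quotient finmap.
From mathcomp Require Import all_classical all_reals all_analysis.
Set Implicit Arguments.
Unset Strict Implicit.
Unset Printing Implicit Defensive.
Import Order.TTheory GRing.Theory Num.Theory.
Import numFieldNormedType.Exports.
Local Open Scope classical_set_scope.
Local Open Scope ring_scope.
Local Open Scope quotient_scope.

(* S^1 = R / Z, as the quotient group; clockwise is the direction of
   increasing reals. *)
Definition int_subgroup (R : realType) : zmodClosed R :=
  GRing.ZmodClosed.clone R (@Num.int_num_subdef R) _.

Definition circle (R : realType) : Type := Quotient.quot (int_subgroup R).

HB.instance Definition _ (R : realType) := Choice.on (circle R).
HB.instance Definition _ (R : realType) := GRing.Zmodule.on (circle R).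
HB.instance Definition _ (R : realType) := EqQuotient.on (circle R).
HB.instance Definition _ (R : realType) := ZmodQuotient.on (circle R).
HB.instance Definition _ (R : realType) := isPointed.Build (circle R) 0.

Definition to_circle {R : realType} (t : R) : circle R := \pi_(circle R) t.

(* A set is measurable iff its preimage in R is Borel; this is the Borel
   sigma-algebra of S^1. *)
Definition circle_measurable (R : realType) : set_system (circle R) :=
  image_set_system setT (@to_circle R) measurable.

Section circle_measurable.
Variable R : realType.
Let sigma := sigma_algebra_image (@to_circle R)
  (@sigma_algebra_measurable _ (measurableTypeR R)).

Let circle_measurable0 : @circle_measurable R set0.
Proof. by case: sigma. Qed.

Let circle_measurableC (A : set (circle R)) :
  circle_measurable A -> circle_measurable (~` A).
Proof. by case: sigma => _ /(_ A) + _; rewrite setTD. Qed.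

Let circle_measurable_bigcup (F : (set (circle R))^nat) :
  (forall i, circle_measurable (F i)) -> circle_measurable (\bigcup_i F i).
Proof. by case: sigma => _ _; exact. Qed.

HB.instance Definition _ := @isMeasurable.Build default_measure_display
  (circle R) (@circle_measurable R)
  circle_measurable0 circle_measurableC circle_measurable_bigcup.
End circle_measurable.

(* Length along the circle, of total mass 1. *)
Definition circle_measure {R : realType} (A : set (circle R)) : \bar R :=
  lebesgue_measure (`[0%R, 1%R[ `&` to_circle @^-1` A).

Section dynamics.
Variable R : realType.

(* The arc [x, x + s)_{S^1}, for 0 < s <= 1 (the whole circle when s = 1). *)
Definition arc (x : circle R) (s : R) : set (circle R) :=
  [set x + to_circle t | t in `[0, s[].

(* Length in [0, 1[ of the clockwise arc from x to y: the fractional part of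
   any representative of y - x. *)
Definition clockwise_dist (x y : circle R) : R :=
  let t := repr (y - x) in t - (Num.floor t)%:~R.

Definition jump (X : {fset circle R}) (r : R) (x : X) : X :=
  [arg max_(y > x | \val y \in arc (\val x) r)
    clockwise_dist (\val x) (\val y)]%O.

Definition periodic (X : {fset circle R}) (r : R) (x : X) : Prop :=
  exists2 i, (1 <= i)%N & iter i (jump r) x = x.

Definition per (X : {fset circle R}) (r : R) : nat :=
  #|[pred x : X | `[< periodic r x >] ]|.

(* Supremum in the extended reals.  Denominators are positive; p / q need not
   be in lowest terms. *)
Definition irrationality_exponent (r : R) : \bar R :=
  ereal_sup [set alpha%:E | alpha in [set alpha : R |
    infinite_set [set pq : int * int | 0 < pq.2 /\
      0 < `|r - pq.1%:~R / pq.2%:~R| < 1 / pq.2%:~R `^ alpha]]].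
End dynamics.

Section random_points.
Context {R : realType} {d} {T : measurableType d}.

Definition uniform_on_circle (P : probability T R)
    (X : {RV P >-> circle R}) : Prop :=
  forall A, measurable A -> distribution P X A = circle_measure A.

Definition mutually_independent (P : probability T R) d'
    (T' : measurableType d') (I : finType) (X : I -> {RV P >-> T'}) : Prop :=
  forall (J : {set I}) (A : I -> set T'), (forall i, measurable (A i)) ->
    P (\bigcap_(i in [set` J]) (X i @^-1` A i)) =
    (\prod_(i in J) P (X i @^-1` A i))%E.

Definition random_set n (X : 'I_n -> T -> circle R) (w : T) :
    {fset circle R} :=
  [fset X i w | i : 'I_n]%fset.
End random_points.
Arguments uniform_on_circle {R d T} P X.
Arguments mutually_independent {R d T} P {d' T' I} X.

(* Main.v *)
(* Sum the clockwise steps along an orbit of period q of the jump map: the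
   total is an integer p.  Cut the circle into K equal cells.  If each of them
   contains a point of X, every step has length in [r - 2/K, r[, so that
   0 < r - p/q <= 2/K, and since r has irrationality exponent 2 this forces
   q, hence per(X, r), to be at least of order K^(1/(2 + delta)).  With
   K ~ n^(1 - delta) cells, the probability that n random points miss some
   cell is at most K (1 - 1/K)^n <= n exp(- n^delta), which tends to 0. *)
Require Import Defs.
From mathcomp Require Import all_boot all_order all_algebra finmap.
From mathcomp Require Import generic_quotient ring_quotient.
From mathcomp Require Import all_classical all_reals all_analysis.
From mathcomp Require Import measurable_realfun lra ring zify.
Import Order.TTheory GRing.Theory Num.Theory.
Import numFieldNormedType.Exports.
Local Open Scope classical_set_scope.
Local Open Scope ring_scope.

Set Implicit Arguments.
Unset Strict Implicit.

(** * Clockwise distances on the circle *)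

Section circle.
Variable R : realType.
Implicit Types (s t : R) (x y z : circle R).

Lemma to_circle_sum (I : Type) (l : seq I) (t : I -> R) :
  to_circle (\sum_(i <- l) t i) = \sum_(i <- l) to_circle (t i).
Proof. by rewrite /to_circle raddf_sum. Qed.

Lemma to_circleD s t : to_circle (s + t) = to_circle s + to_circle t.
Proof. by rewrite /to_circle raddfD. Qed.

Lemma to_circleB s t : to_circle (s - t) = to_circle s - to_circle t.
Proof. by rewrite /to_circle raddfB. Qed.

Lemma to_circle_eq0 t : (to_circle t == 0) = (t \is a Num.int).
Proof.
have -> : 0 = to_circle (0 : R) by rewrite /to_circle raddf0.
rewrite /to_circle eqquotE Quotient.equivE subr0; exact: erefl.
Qed.

Definition frac_part t : R := t - (Num.floor t)%:~R.

Lemma frac_part_itv t : 0 <= frac_part t < 1.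
Proof.
rewrite subr_ge0 ltrBlDl floor_le /=.
by have := floorD1_gt t; rewrite intrD addrC.
Qed.

Lemma to_circle_frac_part t : to_circle (frac_part t) = to_circle t.
Proof.
rewrite to_circleB; have /eqP -> : to_circle (Num.floor t)%:~R == 0 :> circle R.
  by rewrite to_circle_eq0.
by rewrite subr0.
Qed.

Lemma clockwise_distE x y : clockwise_dist x y = frac_part (repr (y - x)).
Proof. by []. Qed.

Lemma clockwise_dist_itv x y : 0 <= clockwise_dist x y < 1.
Proof. exact: frac_part_itv. Qed.

Lemma to_circle_clockwise_dist x y : to_circle (clockwise_dist x y) = y - x.
Proof. by rewrite clockwise_distE to_circle_frac_part /to_circle reprK. Qed.

Lemma to_circle_inj_itv s t : 0 <= s < 1 -> 0 <= t < 1 ->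
  to_circle s = to_circle t -> s = t.
Proof.
move=> /andP[s0 s1] /andP[t0 t1] /eqP; rewrite -subr_eq0 -to_circleB to_circle_eq0.
move=> /intrP[m stm].
have m_gt : -1 < m by rewrite -(ltr_int R) -stm intrN; lra.
have m_lt : m < 1 by rewrite -(ltr_int R) -stm; lra.
have m0 : m = 0 by lia.
by apply/eqP; rewrite -subr_eq0 stm m0.
Qed.

(** The tool for computing distances: any representative of [y - x] in [[0, 1)] will do, so the
    arbitrary choice made by [repr] never has to be examined. *)
Lemma clockwise_dist_unique x y t : 0 <= t < 1 -> to_circle t = y - x ->
  clockwise_dist x y = t.
Proof.
move=> t01 txy; apply: to_circle_inj_itv => //; first exact: clockwise_dist_itv.
by rewrite to_circle_clockwise_dist.
Qed.

Lemma clockwise_dist_inj x : injective (clockwise_dist x).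
Proof.
by move=> y z /(congr1 to_circle); rewrite !to_circle_clockwise_dist => /addIr.
Qed.

Lemma clockwise_distxx x : clockwise_dist x x = 0.
Proof.
apply: clockwise_dist_unique; first by rewrite lexx ltr01.
by rewrite subrr /to_circle raddf0.
Qed.

(** With [s <= 1], the parameter of a point of the arc lies in [[0, 1)] and is therefore its
    clockwise distance from [x]. *)
Lemma mem_arc x y s : s <= 1 -> (y \in Defs.arc x s) = (clockwise_dist x y < s).
Proof.
move=> s1; apply/idP/idP => [/set_mem [t /=]|cs].
  rewrite in_itv /= => /andP[t0 ts] <-.
  rewrite (@clockwise_dist_unique _ _ t) ?t0 ?(lt_le_trans ts)//.
  by rewrite addrC addrA addNr add0r.
apply/mem_set; exists (clockwise_dist x y) => /=.
  by rewrite in_itv /= cs andbT; case/andP: (clockwise_dist_itv x y).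
by rewrite to_circle_clockwise_dist addrC subrK.
Qed.

Lemma measurable_frac_part : measurable_fun setT frac_part.
Proof.
apply: measurable_funB => //.
apply: nondecreasing_measurable => // s t st.
by rewrite ler_int le_floor.
Qed.
End circle.

(** * The jump map through clockwise distances *)

Section jump.
Variables (R : realType) (r : R).
Hypotheses (r_gt0 : 0 < r) (r_le1 : r <= 1).
Variable X : {fset circle R}.
Implicit Types x y z : X.

Lemma jumpP x : clockwise_dist (val x) (val (jump r x)) < r /\
  (forall y, clockwise_dist (val x) (val y) < r ->
     clockwise_dist (val x) (val y) <= clockwise_dist (val x) (val (jump r x))).
Proof.
rewrite /jump; case: arg_maxP => [|y yr ymax].
  (* The default value [x] of the arg max must be admissible: it is at distance 0 from itself. *)
  by rewrite mem_arc// clockwise_distxx.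
by move: yr; rewrite mem_arc//; split=> // z zr; apply: ymax; rewrite mem_arc.
Qed.

(** Distinct points have distinct clockwise distances from [x], so the maximum is attained without
    ties. *)
Lemma jump_unique x y : clockwise_dist (val x) (val y) < r ->
  (forall z, clockwise_dist (val x) (val z) < r ->
     clockwise_dist (val x) (val z) <= clockwise_dist (val x) (val y)) ->
  jump r x = y.
Proof.
move=> yr ymax; have [jr jmax] := jumpP x.
apply: val_inj; apply: (@clockwise_dist_inj _ (fsval x)); apply/le_anti.
by rewrite ymax//= jmax.
Qed.
End jump.

(** * Rational approximation of [r] from a periodic orbit *)

Section rotation.
Variable R : realType.

Definition cell (K k : nat) : set (circle R) :=
  [set c | k%:R / K%:R <= clockwise_dist 0 c < k.+1%:R / K%:R].

Variables (r : R) (X : {fset circle R}).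
Implicit Types x y : X.

(** In the circle the steps telescope to 0, so their real sum is in the kernel of [to_circle]. *)
Lemma orbit_sum_int (q : nat) x : iter q (jump r) x = x ->
  \sum_(0 <= i < q) clockwise_dist (val (iter i (jump r) x))
    (val (iter i.+1 (jump r) x)) \is a Num.int.
Proof.
move=> xq; rewrite -to_circle_eq0 to_circle_sum.
under eq_bigr do rewrite to_circle_clockwise_dist.
by rewrite (telescope_sumr (fun i => val (iter i (jump r) x)))// xq subrr.
Qed.

(** On a finite set the forward orbit of [x0] first repeats at time [order f x0], where it returns
    to some iterate [i]. The [q] points from [i] on form a cycle of distinct periodic points, whence
    [q <= per X r]. *)
Lemma exists_long_orbit (x0 : X) :
  exists2 q : nat, (0 < q <= per X r)%N & exists x, iter q (jump r) x = x.
Proof.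
set f := jump r.
have /trajectP[i i_lt fi] : looping f x0 (order f x0) := looping_order f x0.
set y := iter i f x0; set q := (order f x0 - i)%N.
have yq : iter q f y = y by rewrite -iterD subnK ?fi// ltnW.
exists q; last by exists y.
rewrite subn_gt0 i_lt/=.
have traj_uniq : uniq (traject f y q).
  have := orbit_uniq f x0; rewrite /orbit -(subnKC (ltnW i_lt)) -/q.
  by rewrite trajectD cat_uniq => /and3P[].
rewrite /per -[leqLHS](size_traject f y q) -(card_uniqP traj_uniq).
apply: subset_leq_card; apply/fintype.subsetP => z /trajectP[j jq ->].
rewrite inE; exists q; first by rewrite subn_gt0.
by rewrite -iterD addnC iterD yq.
Qed.

Variable K : nat.
Hypotheses (K_gt0 : (0 < K)%N) (r_le1 : r <= 1) (K_r : 2 / K%:R <= r).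
Hypothesis cell_hit : forall k : 'I_K, exists y, cell K k (val y).

(** The arc of length [2/K] that ends at [x + r] contains a whole cell, hence a point of [X]; the
    jump goes at least as far as this point. *)
Lemma clockwise_dist_jump_ge x :
  r - 2 / K%:R <= clockwise_dist (val x) (val (jump r x)).
Proof.
have K0 : 0 < K%:R :> R by rewrite ltr0n.
have r_gt0 : 0 < r by apply: lt_le_trans K_r; rewrite divr_gt0.
set u := clockwise_dist 0 (val x).
have /andP[u0 u1] : 0 <= u < 1 := clockwise_dist_itv 0 (val x).
(* In units of [1/K] from 0, that arc runs from [a] to [a + 2]. The integer [k] with
   [k - 1 <= a < k] gives a cell from [k] to [k + 1] within it. *)
pose a := K%:R * (u + r) - 2.
have a0 : 0 <= a.
  rewrite subr_ge0 mulrDr -[leLHS]add0r lerD ?mulr_ge0// mulrC.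
  by rewrite -ler_pdivrMr.
set k := (Num.truncn a).+1.
have /andP[ka ak] : k%:R - 1 <= a < k%:R.
  by have := truncn_itv a0; rewrite /k -natr1 addrK.
(* The arc may pass 0, so the cell index is [k] modulo [K]; the full turns [k %/ K] are added back
   in [t], which is congruent to [y - x] modulo 1. *)
have [y] := cell_hit (Ordinal (ltn_pmod k K_gt0)).
rewrite /cell/=; set v := clockwise_dist 0 (val y) => /andP[vge vlt].
rewrite ler_pdivrMr// in vge; rewrite ltr_pdivlMr// in vlt.
pose t := (k %/ K)%:R + v - u.
have kE : k%:R = (k %/ K)%:R * K%:R + (k %% K)%:R :> R.
  by rewrite -natrM -natrD -divn_eq.
have tK : t * K%:R = (k %/ K)%:R * K%:R + v * K%:R - u * K%:R.
  by rewrite /t; ring.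
have aE : a = K%:R * u + K%:R * r - 2 by rewrite /a mulrDr.
have t_ge : r - 2 / K%:R <= t.
  rewrite -(ler_pM2r K0) tK mulrBl divfK ?gt_eqF//.
  by rewrite [r * _]mulrC [u * _]mulrC; lra.
have t_lt : t < r.
  rewrite -(ltr_pM2r K0) tK.
  by rewrite [r * _]mulrC [u * _]mulrC -natr1 in vlt *; lra.
have t01 : 0 <= t < 1.
  by rewrite (lt_le_trans t_lt)// (le_trans _ t_ge)// subr_ge0.
have ty : clockwise_dist (val x) (val y) = t.
  apply: clockwise_dist_unique => //.
  rewrite to_circleB to_circleD !to_circle_clockwise_dist !subr0.
  have /eqP -> : to_circle (k %/ K)%:R == 0 :> circle R by rewrite to_circle_eq0.
  by rewrite add0r.
by apply: (le_trans t_ge); rewrite -ty; apply: (jumpP r_gt0 r_le1 x).2; rewrite ty.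
Qed.

Lemma per_rational_approximation : exists (p : int) (q : nat),
  (0 < q <= per X r)%N /\ 0 < r - p%:~R / q%:R <= 2 / K%:R.
Proof.
have [y0 _] := cell_hit (Ordinal K_gt0).
have r_gt0 : 0 < r by apply: lt_le_trans K_r; rewrite divr_gt0 ?ltr0n.
have [q /andP[q_gt0 q_per] [x xq]] := exists_long_orbit y0.
have /intrP[p sumE] := orbit_sum_int xq.
exists p, q; rewrite q_gt0 q_per; split=> //.
have q0 : 0 < q%:R :> R by rewrite ltr0n.
(* Multiplied by [q], the claim places [p], the sum of the [q] steps, between [q] copies of
   [r - 2/K] and [q] copies of [r], which is checked term by term. *)
rewrite subr_gt0 ltr_pdivrMr// lerBlDr -lerBlDl ler_pdivlMr// -sumE.
rewrite !mulr_natr -[in X in _ < X](subn0 q) -[in X in X <= _](subn0 q) -!sumr_const_nat.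
apply/andP; split.
  (* Strictness requires a nonempty sum, which [0 < q] provides. *)
  rewrite !big_nat; apply: ltr_sum => //.
  - by apply/hasP; exists 0%N => //; rewrite mem_index_iota.
  - by move=> i _; exact: (jumpP r_gt0 r_le1 _).1.
by apply: ler_sum => i _; exact: clockwise_dist_jump_ge.
Qed.
End rotation.

(** * Measurability of the number of periodic points *)

Section measurable_per.
Variables (R : realType) (r : R).
Hypotheses (r_gt0 : 0 < r) (r_le1 : r <= 1).
Variable n : nat.
Implicit Types x : 'I_n -> circle R.

Definition points x : {fset circle R} := [fset x i | i : 'I_n]%fset.

Lemma mem_points x i : x i \in points x.
Proof. by apply/imfsetP; exists i. Qed.

Definition point_at x i : points x := [` mem_points x i]%fset.

Lemma point_at_surj x (y : points x) : exists i, y = point_at x i.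
Proof.
have /imfsetP[i _ yi] := fsvalP y.
by exists i; apply: val_inj.
Qed.

Lemma jump_point_at x i j : jump r (point_at x i) = point_at x j <->
  clockwise_dist (x i) (x j) < r /\
  (forall k, clockwise_dist (x i) (x k) < r ->
     clockwise_dist (x i) (x k) <= clockwise_dist (x i) (x j)).
Proof.
split=> [jij|[ijr jmax]].
  have [] := jumpP r_gt0 r_le1 (point_at x i); rewrite jij => ijr jmax.
  by split=> // k; exact: (jmax (point_at x k)).
by apply: jump_unique => // z; have [k ->] := point_at_surj z; exact: jmax.
Qed.

(** A finite-valued record of the comparisons between distances. It determines the jump map up to
    renaming of the points, and each comparison is a measurable event. *)
Definition pattern x : {ffun 'I_n * 'I_n * 'I_n -> bool * bool} :=
  [ffun t => let: (i, j, k) := t in (clockwise_dist (x i) (x j) < r,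
     clockwise_dist (x i) (x j) <= clockwise_dist (x i) (x k))].

Section same_pattern.
Variables x x' : 'I_n -> circle R.
Hypothesis xx' : pattern x = pattern x'.

Lemma pattern_lt i j :
  (clockwise_dist (x i) (x j) < r) = (clockwise_dist (x' i) (x' j) < r).
Proof. by have /ffunP/(_ (i, j, j)) := xx'; rewrite !ffunE => -[]. Qed.

Lemma pattern_le i j k :
  (clockwise_dist (x i) (x j) <= clockwise_dist (x i) (x k)) =
  (clockwise_dist (x' i) (x' j) <= clockwise_dist (x' i) (x' k)).
Proof. by have /ffunP/(_ (i, j, k)) := xx'; rewrite !ffunE => -[]. Qed.

(* Coincidences are visible in the pattern: [x j = x i] iff the distance from
   [x i] to [x j] is at most the null distance from [x i] to itself. *)
Lemma pattern_eq i j : (point_at x i == point_at x j) = (point_at x' i == point_at x' j).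
Proof.
have eqE z : (point_at z i == point_at z j) =
    (clockwise_dist (z i) (z j) <= clockwise_dist (z i) (z i)).
  rewrite clockwise_distxx -val_eqE/=; apply/eqP/idP => [->|zij].
    by rewrite clockwise_distxx.
  apply/esym/(@clockwise_dist_inj _ (z i))/le_anti.
  by rewrite clockwise_distxx zij; case/andP: (clockwise_dist_itv (z i) (z j)).
by rewrite !eqE pattern_le.
Qed.

Lemma pattern_jump i j :
  jump r (point_at x i) = point_at x j -> jump r (point_at x' i) = point_at x' j.
Proof.
move=> /jump_point_at[ijr jmax]; apply/jump_point_at; rewrite -pattern_lt.
by split=> // k; rewrite -pattern_lt -pattern_le; exact: jmax.
Qed.

Lemma pattern_iter m i j : iter m (jump r) (point_at x i) = point_at x j ->
  iter m (jump r) (point_at x' i) = point_at x' j.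
Proof.
elim: m j => [|m IH] j /=; first by move/eqP; rewrite pattern_eq => /eqP.
have [k mk] := point_at_surj (iter m (jump r) (point_at x i)).
by rewrite mk (IH _ mk); exact: pattern_jump.
Qed.

(** Choosing an index for each point of [points x] and reading it in [x'] gives a map that is
    injective, since coincidences agree, and keeps periodic points periodic. *)
Lemma pattern_per_le : (per (points x) r <= per (points x') r)%N.
Proof.
pose idx (y : points x) := projT1 (cid (point_at_surj y)).
have idxK y : y = point_at x (idx y) by rewrite /idx; case: cid.
pose h (y : points x) := point_at x' (idx y).
have h_inj : injective h.
  by move=> y z /eqP; rewrite -pattern_eq -!idxK => /eqP.
rewrite /per -(fintype.card_image h_inj).
apply: subset_leq_card; apply/fintype.subsetP => _ /fintype.imageP[y yP ->].
move: yP; rewrite !inE => -[m m_gt0 ym]; exists m => //.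
by apply: pattern_iter; rewrite -!idxK.
Qed.
End same_pattern.

Lemma pattern_per x x' : pattern x = pattern x' ->
  per (points x) r = per (points x') r.
Proof. by move=> xx'; apply/eqP; rewrite eqn_leq !pattern_per_le. Qed.

(** The sigma-algebra of the circle tests sets after pulling back along [to_circle], where this map
    becomes the fractional part. *)
Lemma measurable_clockwise_dist0 :
  measurable_fun setT (clockwise_dist 0 : circle R -> R).
Proof.
move=> _ B mB; rewrite setTI.
suff frac0 : @to_circle R @^-1` (clockwise_dist 0 @^-1` B) = @frac_part R @^-1` B.
  rewrite /measurable/= /circle_measurable /image_set_system/= frac0.
  exact: (@measurable_frac_part R measurableT B mB).
rewrite -comp_preimage.
suff -> : clockwise_dist 0 \o @to_circle R = @frac_part R by [].
apply/funext => t /=.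
apply: clockwise_dist_unique; first exact: frac_part_itv.
by rewrite to_circle_frac_part subr0.
Qed.

(** Expresses the distance through real coordinates measured from 0, so that its measurability in
    both points follows from real arithmetic. *)
Lemma clockwise_dist_frac_part (a b : circle R) :
  clockwise_dist a b = frac_part (clockwise_dist 0 b - clockwise_dist 0 a).
Proof.
apply: clockwise_dist_unique; first exact: frac_part_itv.
by rewrite to_circle_frac_part to_circleB !to_circle_clockwise_dist !subr0.
Qed.

Lemma measurable_clockwise_dist d (T : measurableType d) (f g : T -> circle R) :
  measurable_fun setT f -> measurable_fun setT g ->
  measurable_fun setT (fun w => clockwise_dist (f w) (g w)).
Proof.
move=> mf mg; under eq_fun do rewrite clockwise_dist_frac_part.
apply: (measurableT_comp (@measurable_frac_part R)).
by apply: measurable_funB; apply: (measurableT_comp measurable_clockwise_dist0).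
Qed.

(** [per] is constant on each pattern class, so the event is a finite union of classes; a class is a
    finite intersection of comparison events. *)
Lemma measurable_per d (T : measurableType d) (X : 'I_n -> T -> circle R)
  (mX : forall i, measurable_fun setT (X i)) (B : set nat) :
  measurable [set w | B (per (random_set X w) r)].
Proof.
pose pat w := pattern (X^~ w).
have mpat p : measurable [set w | pat w = p].
  rewrite (_ : [set w | _] = \bigcap_t [set w | pat w t = p t]); last first.
    apply/seteqP; split=> [w /= <- //|w wp]; apply/ffunP => t; exact: wp.
  apply: fin_bigcap_measurable; [exact: finite_finset|move=> [[i j] k] _].
  rewrite /pat; under eq_set do rewrite ffunE.
  have mij := measurable_clockwise_dist (mX i) (mX j).
  have mik := measurable_clockwise_dist (mX i) (mX k).
  have mr := measurable_fun_ltr mij (measurable_cst r).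
  have ml := measurable_fun_ler mij mik.
  have m2 := measurableI _ _ (mr measurableT [set (p (i, j, k)).1] I)
    (ml measurableT [set (p (i, j, k)).2] I).
  rewrite !setTI in m2; apply: eq_ind m2 _ _.
  apply/seteqP; split=> w /=; first by case=> -> ->; rewrite -surjective_pairing.
  by move=> <-.
rewrite (_ : [set w | _] = \bigcup_(p in [set p | exists2 w, pat w = p &
    B (per (random_set X w) r)]) [set w | pat w = p]).
  by apply: fin_bigcup_measurable => [|p _]; [exact: finite_finset|exact: mpat].
apply/seteqP; split=> w /=; first by move=> Bw; exists (pat w) => //; exists w.
move=> [_ [w' <- Bw'] /= ww'].
rewrite (_ : per _ _ = per (random_set X w') r)//.
exact: pattern_per ww'.
Qed.
End measurable_per.

(** * Probability that every cell is hit *)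

Section cells_hit.
Variables (R : realType) (d : measure_display) (T : measurableType d).
Variables (P : probability T R) (n : nat) (X : 'I_n -> {RV P >-> circle R}).
Hypothesis X_uniform : forall i, uniform_on_circle P (X i).
Hypothesis X_indep : mutually_independent P X.
Variable K : nat.
Hypothesis K_gt0 : (0 < K)%N.

Lemma measurable_cell k : measurable (@cell R K k).
Proof.
pose I := `[(k%:R / K%:R : R), k.+1%:R / K%:R[%classic.
have -> : @cell R K k = clockwise_dist 0 @^-1` I.
  by apply/seteqP; split=> c; rewrite /I /preimage/= in_itv.
by rewrite -[X in measurable X]setTI; exact: (@measurable_clockwise_dist0 R measurableT I (measurable_itv _)).
Qed.

Lemma circle_measure_cell (k : nat) : (k < K)%N ->
  circle_measure (@cell R K k) = (K%:R^-1)%:E.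
Proof.
move=> kK; have K0 : 0 < K%:R :> R by rewrite ltr0n.
rewrite /circle_measure (_ : _ `&` _ = `[k%:R / K%:R, k.+1%:R / K%:R[%classic).
  rewrite lebesgue_measure_itv/= lte_fin ltr_pM2r ?invr_gt0// ltr_nat ltnSn.
  by rewrite -EFinB -mulrBl -natrB// subSnn mul1r.
have cell_frac t : 0 <= t < 1 -> clockwise_dist 0 (to_circle t) = t.
  by move=> t01; apply: clockwise_dist_unique; rewrite ?subr0.
apply/seteqP; split=> t /=; rewrite !in_itv/=.
  by case=> t01; rewrite /cell/= cell_frac.
move=> /andP[kt tk]; have t01 : 0 <= t < 1.
  rewrite (le_trans _ kt) ?divr_ge0//= (lt_le_trans tk)//.
  by rewrite ler_pdivrMr// mul1r ler_nat.
by split=> //; rewrite /cell/= cell_frac// kt tk.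
Qed.

Definition missed k : set T := \bigcap_i (X i @^-1` (~` @cell R K k)).

Lemma measurable_missed k : measurable (missed k).
Proof.
apply: fin_bigcap_measurable; first exact: finite_finset.
move=> i _; rewrite -[X in measurable X]setTI; apply: measurable_funPT => //.
by apply: measurableC; exact: measurable_cell.
Qed.

Lemma probability_missed k : (k < K)%N -> P (missed k) = ((1 - K%:R^-1) ^+ n)%:E.
Proof.
move=> kK.
have := X_indep [set: 'I_n]%SET (A := fun=> ~` @cell R K k)
  (fun=> measurableC (measurable_cell k)).
rewrite (_ : \bigcap_(_ in _) _ = missed k); last first.
  by rewrite (_ : [set` _] = setT)//; apply/seteqP; split=> i //=; rewrite inE.
move=> ->; under eq_bigr => i _.
  have -> : P (X i @^-1` (~` @cell R K k)) = (1 - K%:R^-1)%:E.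
    have -> : P (X i @^-1` (~` @cell R K k)) =
      distribution P (X i) (~` @cell R K k) by [].
    rewrite probability_setC; last exact: measurable_cell.
    rewrite [X in (_ - X)%E](X_uniform i (measurable_cell k)).
    by rewrite circle_measure_cell.
  over.
by rewrite prodEFin prodr_const cardsT card_ord.
Qed.

(** Union bound over the [K] events [missed k]; [G] is the complement of their union. *)
Lemma probability_cells_hit : exists G : set T,
  [/\ measurable G,
      forall w, G w -> forall k : 'I_K, exists i, @cell R K k (X i w) &
      ((1 - K%:R * (1 - K%:R^-1) ^+ n)%:E <= P G)%E].
Proof.
pose B := \big[setU/set0]_(k < K) missed k.
have mB : measurable B by apply: bigsetU_measurable => k _; exact: measurable_missed.
exists (~` B); split; first exact: measurableC.
  move=> w + k; apply: contra_notP => no_hit.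
  rewrite /B -bigcup_mkord; exists k => //= i _ hit.
  by apply: no_hit; exists i.
rewrite probability_setC// EFinB leeB//.
apply: le_trans (Boole_inequality _ _) _.
  by move=> k _; exact: measurable_missed.
rewrite (eq_bigr (fun=> ((1 - K%:R^-1) ^+ n)%:E)); last first.
  by move=> k _; exact: probability_missed.
by rewrite sumEFin sumr_const card_ord mulr_natl.
Qed.
End cells_hit.

(** * Diophantine lower bound and decay of the miss probability *)

Section asymptotics.
Variable R : realType.

Lemma seq_pos_lower_bound (I : eqType) (s : seq I) (f : I -> R) :
  (forall i, i \in s -> 0 < f i) ->
  exists2 c : R, 0 < c <= 1 & forall i, i \in s -> c <= f i.
Proof.
elim: s => [_|i s IH f_gt0]; first by exists 1; rewrite ?ltr01 ?lexx.
have [j js|c /andP[c0 c1] cf] := IH; first by rewrite f_gt0// inE js orbT.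
exists (Num.min (f i) c).
  by rewrite lt_min c0 f_gt0 ?mem_head//= ge_min c1 orbT.
move=> j; rewrite inE => /predU1P[->|js]; first by rewrite ge_min lexx.
by rewrite ge_min cf ?orbT.
Qed.

(** For [alpha] above the exponent, only finitely many pairs come closer than [1 / q ^ alpha]. The
    constant [c] is at most 1, for the other pairs, and at most the distance of each exceptional
    one. *)
Lemma irrationality_exponent_bound (r alpha : R) : 0 <= alpha ->
  (irrationality_exponent r < alpha%:E)%E -> exists2 c : R, 0 < c &
  forall (p : int) (q : nat), (0 < q)%N -> 0 < `|r - p%:~R / q%:R| ->
    c / q%:R `^ alpha <= `|r - p%:~R / q%:R|.
Proof.
move=> alpha0 r_lt.
pose S := [set pq : int * int | 0 < pq.2 /\
  0 < `|r - pq.1%:~R / pq.2%:~R| < 1 / pq.2%:~R `^ alpha].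
have /finite_seqP[s Ss] : finite_set S.
  apply: contrapT => S_inf; move: r_lt; rewrite ltNge => /negP; apply.
  by apply: ereal_sup_ubound; exists alpha.
have [pq|c /andP[c0 c1] cs] := @seq_pos_lower_bound _ s
    (fun pq => `|r - pq.1%:~R / pq.2%:~R|).
  by move=> pqs; have [_ /andP[]] : S pq by rewrite Ss.
exists c => // p q q0 pq0.
have q_ge1 : 1 <= q%:R `^ alpha :> R.
  by rewrite -[leLHS](powRr0 q%:R) ler_powR// ler1n.
have qa0 : 0 < q%:R `^ alpha :> R by apply: lt_le_trans q_ge1.
have [pq_lt|pq_ge] := ltP `|r - p%:~R / q%:R| (1 / q%:R `^ alpha); last first.
  by apply: le_trans pq_ge; rewrite ler_pM2r ?invr_gt0.
apply: (@le_trans _ _ c); first by rewrite ler_pdivrMr// ler_peMr// ltW.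
have : S (p, Posz q) by split=> //=; apply/andP.
by rewrite Ss; exact: cs.
Qed.

Lemma powR_near_gt (a M : R) : 0 < a -> \forall n \near \oo, M < n%:R `^ a.
Proof.
move=> a0; have M0 : 0 <= Num.max M 0 by rewrite le_max lexx orbT.
near=> n; apply: (@le_lt_trans _ _ (Num.max M 0)); first by rewrite le_max lexx.
have -> : Num.max M 0 = (Num.max M 0 `^ a^-1) `^ a.
  by rewrite -powRrM mulVf ?gt_eqF// powRr1.
apply: gt0_ltr_powR => //; rewrite ?nnegrE ?powR_ge0//.
by near: n; exact: nbhs_infty_gtr.
Unshelve. all: by end_near. Qed.

(** From [n / K >= n ^ delta] one gets [(1 - 1/K) ^ n <= exp (- n / K)], and a single term of the
    exponential series bounds this by a constant over [n ^ 2]; the factor [K <= n] leaves [C / n],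
    uniformly in [K]. *)
Lemma miss_bound (delta : R) : 0 < delta < 1 -> exists C : R,
  \forall n \near \oo, forall K : nat, (0 < K)%N -> K%:R <= n%:R `^ (1 - delta) ->
    K%:R * (1 - K%:R^-1) ^+ n <= C / n%:R.
Proof.
(* The degree [m + 1] is large enough that [(n ^ delta) ^ (m + 1) >= n ^ 2]. *)
move=> /andP[d0 d1]; pose m := Num.truncn (2 / delta).
have m2 : 2 <= m.+1%:R * delta.
  by rewrite -ler_pdivrMr// ltW// truncnS_gt.
exists m.+1`!%:R; near=> n => K K0 Kn.
have n1 : 1 <= n%:R :> R by rewrite ler1n; near: n; exact: nbhs_infty_gt.
have n0 : 0 < n%:R :> R by apply: lt_le_trans n1.
have KR : 0 < K%:R :> R by rewrite ltr0n.
have Kle : K%:R <= n%:R :> R.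
  by apply: (le_trans Kn); rewrite ler1_powR// gerBl ltW.
have nK : n%:R `^ delta <= n%:R / K%:R.
  rewrite ler_pdivlMr// (le_trans (ler_wpM2l (powR_ge0 _ _) Kn))//.
  rewrite -powRD; first by rewrite subrKC powRr1// ltW.
  by rewrite (gt_eqF n0) implybT.
have step1 : (1 - K%:R^-1) ^+ n <= expR (- (n%:R / K%:R)) :> R.
  have -> : - (n%:R / K%:R) = n%:R * - K%:R^-1 :> R by ring.
  rewrite expRM_natl lerXn2r// ?nnegrE ?expR_ge0//.
    by rewrite subr_ge0 invf_le1// ler1n.
  exact: expR_ge1Dx.
have step2 : expR (- (n%:R / K%:R)) <= m.+1`!%:R / n%:R ^+ 2 :> R.
  have F0 : 0 < m.+1`!%:R :> R by rewrite ltr0n fact_gt0.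
  have n20 : 0 < n%:R ^+ 2 :> R by rewrite exprn_gt0.
  rewrite expRN -[leRHS]invrK lef_pV2 ?posrE ?expR_gt0 ?invr_gt0 ?divr_gt0//.
  rewrite invf_div; apply: (@le_trans _ _ ((n%:R / K%:R) ^+ m.+1 / m.+1`!%:R)).
    rewrite ler_pM2r ?invr_gt0 ?ltr0n ?fact_gt0//.
    apply: (@le_trans _ _ ((n%:R `^ delta) ^+ m.+1)).
      rewrite -!powR_mulrn ?powR_ge0 ?(ltW n0)// -powRrM.
      by rewrite ler_powR// mulrC.
    by rewrite lerXn2r// ?nnegrE ?powR_ge0// divr_ge0// ltW.
  apply: le_trans (expR_ge1Dxn m _); first by rewrite lerDr.
  by rewrite divr_ge0// ltW.
have -> : m.+1`!%:R / n%:R = n%:R * (m.+1`!%:R / n%:R ^+ 2) :> R.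
  by field; rewrite gt_eqF.
apply: ler_pM => //.
  by rewrite exprn_ge0// subr_ge0 invf_le1// ler1n.
exact: le_trans step1 step2.
Unshelve. all: by end_near. Qed.
End asymptotics.

(** * Asymptotics of the probability and of the expectation *)

Section per_asymptotics.
Variables (R : realType) (r : R).
Hypotheses (r_gt0 : 0 < r) (r_lt1 : r < 1).
Hypothesis r_exponent : irrationality_exponent r = (2 : R)%:E.
Variable eps : R.
Hypothesis eps_gt0 : 0 < eps.

(* With [K] about [n `^ (1 - delta)] cells, each of them hit, the
   denominator [q <= per] of the rational approximation satisfies
   [q `^ (2 + delta) >= c K / 2], and
   [(1 / 2 - delta) * (2 + delta) < 1 - delta]. *)
Lemma per_gt_cells_hit : exists2 delta : R, 0 < delta < 1 &
  \forall n \near \oo, exists K : nat,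
  [/\ (0 < K)%N, K%:R <= n%:R `^ (1 - delta) &
      forall X : {fset circle R},
      (forall k : 'I_K, exists y : X, cell K k (val y)) ->
      n%:R `^ (1 / 2 - eps) < (per X r)%:R].
Proof.
(* [delta <= eps] lets [1/2 - eps] be replaced by [1/2 - delta]; the cap [1/2] keeps [1 - delta]
   positive. *)
pose delta := Num.min eps (1 / 2).
have d0 : 0 < delta by rewrite lt_min eps_gt0 divr_gt0.
have d2 : delta <= 1 / 2 by rewrite ge_min lexx orbT.
have de : delta <= eps by rewrite ge_min lexx.
have d1 : 0 < 1 - delta by lra.
have a0 : 0 < 2 + delta by lra.
have [|c c0 dioph] := @irrationality_exponent_bound _ r _ (ltW a0).
  by rewrite r_exponent lte_fin; lra.
exists delta; first by apply/andP; split; lra.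
near=> n; exists (Num.truncn (n%:R `^ (1 - delta) : R)).
have n1 : 1 <= n%:R :> R by rewrite ler1n; near: n; exact: nbhs_infty_gt.
have n0 : 0 < n%:R :> R by apply: lt_le_trans n1.
set u := n%:R `^ (1 - delta); set K := Num.truncn u.
(* Three thresholds on [n]: the first gives [u < 2 K], the second then gives [2 / K <= r], and the
   third absorbs the Diophantine constant [c]. *)
have u2 : 2 < u by rewrite /u; near: n; exact: powR_near_gt.
have ur : 4 / r < u by rewrite /u; near: n; exact: powR_near_gt.
have uc : 4 / c < n%:R `^ (delta / 2) by near: n; apply: powR_near_gt; lra.
have /andP[Ku uK] : K%:R <= u < K%:R + 1.
  by rewrite natr1; apply: truncn_itv; exact: powR_ge0.
have uK2 : u < 2 * K%:R by lra.
have K0 : 0 < K%:R :> R by lra.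
have Kr : 2 / K%:R <= r.
  rewrite ler_pdivrMr// -ler_pdivrMl//.
  by move: ur; rewrite [4 / r]mulrC; lra.
split=> //; first by rewrite -(ltr0n R).
move=> X hit; have K_gt0 : (0 < K)%N by rewrite -(ltr0n R).
have [p [q [/andP[q0 q_per] /andP[rpq_gt rpq_le]]]] :=
  per_rational_approximation K_gt0 (ltW r_lt1) Kr hit.
apply: lt_le_trans (_ : q%:R <= _); last by rewrite ler_nat.
have q1 : 0 < q%:R :> R by rewrite ltr0n.
have := dioph p q q0; rewrite gtr0_norm// => /(_ rpq_gt) /le_trans/(_ rpq_le).
have qa0 : 0 < q%:R `^ (2 + delta) :> R by rewrite powR_gt0.
rewrite ler_pdivrMr// mulrAC ler_pdivlMr// => cq.
(* If [q <= n ^ (1/2 - eps)], then [c u < 2 c K <= 4 q ^ (2 + delta) <= 4 n ^ (1 - 3 delta / 2)],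
   while the third threshold makes the last term less than [c u]. *)
rewrite ltNge; apply/negP => qn.
have qd : q%:R `^ (2 + delta) <= n%:R `^ (1 - delta - delta / 2).
  apply: (@le_trans _ _ ((n%:R `^ (1 / 2 - eps)) `^ (2 + delta))).
    by apply: ge0_ler_powR; rewrite ?nnegrE ?powR_ge0// ltW.
  rewrite -powRrM ler_powR//.
  apply: (@le_trans _ _ ((1 / 2 - delta) * (2 + delta))).
    by rewrite ler_pM2r//; lra.
  by have := mulr_gt0 d0 d0; lra.
have uE : u = n%:R `^ (1 - delta - delta / 2) * n%:R `^ (delta / 2).
  rewrite -powRD; first by rewrite subrK.
  by rewrite (gt_eqF n0) implybT.
have v0 : 0 < n%:R `^ (1 - delta - delta / 2) :> R by rewrite powR_gt0.
have : 4 / c * n%:R `^ (1 - delta - delta / 2) < u.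
  by rewrite uE mulrC ltr_pM2l.
rewrite mulrAC ltr_pdivrMr//.
have : c * u < c * (2 * K%:R) by rewrite ltr_pM2l.
by rewrite [u * c]mulrC; lra.
Unshelve. all: by end_near. Qed.

Variables (d : nat -> measure_display) (T : forall n : nat, measurableType (d n)).
Variables (P : forall n : nat, probability (T n) R).
Variable X : forall n : nat, 'I_n -> {RV (P n) >-> circle R}.
Hypothesis X_uniform : forall (n : nat) (i : 'I_n), uniform_on_circle (P n) (X i).
Hypothesis X_indep : forall n : nat, mutually_independent (P n) (@X n).

Local Notation large n := [set w | n%:R `^ (1 / 2 - eps) <
  (per (random_set (@X n) w) r)%:R].

Lemma measurable_large n : measurable (large n).
Proof.
exact: (measurable_per r_gt0 (ltW r_lt1) (fun i => measurable_funPT (@X n i))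
  [set m | n%:R `^ (1 / 2 - eps) < m%:R]).
Qed.

(** The rate serves both conclusions: it forces the limit 1, and it makes the probability at least
    [1/2] eventually. *)
Lemma probability_large_ge : exists C : R,
  \forall n \near \oo, ((1 - C / n%:R)%:E <= P n (large n))%E.
Proof.
have [delta d01 per_gt] := per_gt_cells_hit.
have [C missC] := miss_bound d01.
exists C; near=> n.
have [|K [K_gt0 Kn Klarge]] := near per_gt n; first by [].
have [G [mG hitG PG]] := probability_cells_hit (@X_uniform n) (@X_indep n) K_gt0.
apply: (@le_trans _ _ (P n G)).
  apply: le_trans PG; rewrite lee_fin lerB//.
  exact: (near missC n).
apply: le_measure; rewrite ?inE//; first exact: measurable_large.
move=> w Gw; apply: Klarge => k; have [i hit] := hitG w Gw k.
by exists (point_at (fun i => X i w) i).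
Unshelve. all: by end_near. Qed.

Lemma probability_large_cvg : P n (large n) @[n --> \oo] --> 1%E.
Proof.
have [C large_ge] := probability_large_ge.
apply: (@squeeze_cvge _ _ _ _ (fun n : nat => (1 - C / n%:R)%:E) _ (fun=> 1%E)).
- near=> n; apply/andP; split; first exact: (near large_ge n).
  exact: probability_le1 (measurable_large n).
- apply: cvg_EFin; first by near=> n.
  rewrite -[X in _ --> X]subr0; apply: cvgB; first exact: cvg_cst.
  rewrite -(mulr0 C); apply: cvgM; first exact: cvg_cst.
  apply/gtr0_cvgV0; last exact: cvgr_idn.
  by near=> n; rewrite ltr0n; near: n; exact: nbhs_infty_gt.
- exact: cvg_cst.
Unshelve. all: by end_near. Qed.

(** Markov's inequality for [per], whose expectation is finite because there are at most [n]
    points. *)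
Lemma expectation_per_ge n :
  n%:R `^ (1 / 2 - eps) * fine (P n (large n)) <=
  fine ('E_(P n)[fun w => (per (random_set (@X n) w) r)%:R]).
Proof.
pose f w : R := (per (random_set (@X n) w) r)%:R.
have mf : measurable_fun setT f.
  move=> _ B mB; rewrite setTI.
  exact: (measurable_per r_gt0 (ltW r_lt1) (fun i => measurable_funPT (@X n i))
    [set m | B m%:R]).
have f_le w : f w <= n%:R.
  rewrite ler_nat (leq_trans (max_card _))// -cardfE.
  by rewrite (leq_trans (leq_imfset_card _ _ _))// size_enum_ord.
have Ef_ge0 : (0 <= \int[P n]_w (f w)%:E)%E.
  by apply: integral_ge0 => w _; rewrite lee_fin.
have Ef_le : (\int[P n]_w (f w)%:E <= n%:R%:E)%E.
  apply: (@le_trans _ _ (\int[P n]_w (cst n%:R%:E w))%E).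
    apply: ge0_le_integral => //.
    - by move=> w _; rewrite lee_fin.
    - exact/measurable_EFinP.
    - by move=> w _; rewrite lee_fin.
  by rewrite integral_cst// [X in (_ * X)%E](probability_setT (P n)) mule1.
have Ef_fin : (\int[P n]_w (f w)%:E)%E \is a fin_num.
  by rewrite ge0_fin_numE// (le_lt_trans Ef_le)// ltry.
have P_fin : P n (large n) \is a fin_num.
  by apply: fin_num_measure; exact: measurable_large.
rewrite unlock -lee_fin EFinM !fineK//.
(* Markov's inequality is applied at a positive threshold; a zero threshold, possible at [n = 0],
   makes the left side 0. *)
have [a0|] := ltP 0 (n%:R `^ (1 / 2 - eps) : R); last first.
  rewrite le_eqVlt ltNge powR_ge0 orbF => /eqP ->.
  by rewrite mul0e.
have mfE : measurable_fun setT (EFin \o f) by exact/measurable_EFinP.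
have := le_integral_abse (P n) measurableT mfE a0.
rewrite (eq_integral (EFin \o f)); last first.
  by move=> w _ /=; rewrite ger0_norm.
apply: le_trans; apply: lee_pmul => //.
apply: le_measure; rewrite ?inE; first exact: measurable_large.
  apply: emeasurable_fun_c_infty => //.
  exact: measurableT_comp.
move=> w /ltW fw; split=> //=.
by rewrite lee_fin ger0_norm.
Qed.
End per_asymptotics.

Unset Implicit Arguments.
Set Strict Implicit.

Theorem theorem5p3 (R : realType) (r : R)
  (r_gt0 : 0 < r) (r_lt1 : r < 1)
  (r_exponent : irrationality_exponent r = (2 : R)%:E)
  (d : nat -> measure_display) (T : forall n : nat, measurableType (d n))
  (P : forall n : nat, probability (T n) R)
  (X : forall n : nat, 'I_n -> {RV (P n) >-> circle R})
  (X_uniform : forall (n : nat) (i : 'I_n), uniform_on_circle (P n) (X n i))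
  (X_indep : forall n : nat, mutually_independent (P n) (X n))
  (eps : R) (eps_gt0 : 0 < eps) :
  (P n [set w | n%:R `^ (1 / 2 - eps) <
                  (per (random_set (X n) w) r)%:R] @[n --> \oo] --> 1%E)
  /\
  ((fun n : nat =>
      fine ('E_(P n)[fun w => (per (random_set (X n) w) r)%:R]) : R^o)
    \is 'Omega_\oo (fun n : nat => n%:R `^ (1 / 2 - eps) : R^o)).
Proof.
split; first exact: probability_large_cvg.
have [C large_ge] :=
  probability_large_ge r_gt0 r_lt1 r_exponent eps_gt0 X_uniform X_indep.
(* The constant [1/2] is a lower bound for the probability as soon as [C / n <= 1/2]; Markov's
   inequality carries it over to the expectation. *)
rewrite qualifE/=; apply/asboolP; exists (1 / 2); first by rewrite divr_gt0.
near=> n.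
have n0 : 0 < n%:R :> R by rewrite ltr0n; near: n; exact: nbhs_infty_gt.
have C_le : C / n%:R <= 1 / 2.
  rewrite ler_pdivrMr// -ler_pdivrMl ?divr_gt0//.
  by apply: ltW; near: n; exact: nbhs_infty_gtr.
have P_ge : 1 / 2 <= fine (P n [set w |
    n%:R `^ (1 / 2 - eps) < (per (random_set (X n) w) r)%:R]).
  have mE := measurable_large r_gt0 r_lt1 eps X n.
  rewrite -lee_fin fineK; last by apply: fin_num_measure.
  by apply: le_trans (near large_ge n _); rewrite ?lee_fin//; lra.
rewrite ger0_norm ?powR_ge0//; apply: le_trans (ler_norm _).
apply: le_trans (expectation_per_ge r_gt0 r_lt1 eps X n).
by rewrite mulrC ler_wpM2l ?powR_ge0.
Unshelve. all: by end_near. Qed.
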